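(* Let $\theta=(\nu,Q,(f_x)_{x\in\mathbb{X}})$ be a parameter such that $\delta:=\min_{x,x'}Q_{x,x'}>0$ and $\min_x\nu_x\ge\delta$, and let $$\Lambda=\int_{\mathbb{Y}}\min_{x_0\in\mathbb{X}}\left[\sum_{x\ne x_0}f_x(y)\right]d\mathcal{L}(y).$$ Then for all $n\ge1$: if $\theta\in\Theta^{\mathrm{ind}}$, $\quad\delta\Lambda\le\inf_{h\in\mathcal{H}_n}\mathcal{R}_n^{\mathrm{class}}(\theta,h)\le(1-(J-1)\delta)\Lambda$; if $\theta\in\Theta^{\mathrm{dep}}$, $\quad\dfrac{\delta^2}{1-(J-1)\delta}\Lambda\le\inf_{h\in\mathcal{H}_n}\mathcal{R}_n^{\mathrm{class}}(\theta,h)\le(1-(J-1)\delta)\Lambda.$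
   Context: Model. $J\ge2$ is an integer, $\mathbb{X}=\{1,\dots,J\}$, $(\mathbb{Y},\mathcal{Y})$ is a Polish space with its Borel $\sigma$-field and $\mathcal{L}$ is a dominating ($\sigma$-finite) measure on it. A parameter is $\theta=(\nu,Q,(f_x)_{x\in\mathbb{X}})$ with $\nu$ a probability vector on $\mathbb{X}$, $Q$ a $J\times J$ transition matrix and $f_x$ probability densities with respect to $\mathcal{L}$. Under $\mathbb{P}_\theta$ (expectation $\mathbb{E}_\theta$), $(X_i)_{i\ge1}$ is a Markov chain on $\mathbb{X}$ with initial law $\nu$ and transition matrix $Q$ and, conditionally on $(X_i)_{i\ge 1}$, the $Y_i$ are independent, $Y_i$ having density $f_{X_i}$. $Y_{1:n}=(Y_1,\dots,Y_n)$. $\Theta^{\mathrm{ind}}$ is the set of parameters for which all rows of $Q$ equal $\nu$ (i.i.d. labels); $\Theta^{\mathrm{dep}}$ is the set of parameters for which the rows of $Q$ are not all equal. Risk. $\mathcal{H}_n$ is the set of measurable maps $h=(h_1,\dots,h_n):\mathbb{Y}^n\to\mathbb{X}^n$ (classifiers) and $\mathcal{R}_n^{\mathrm{class}}(\theta,h)=\mathbb{E}_\theta[\frac1n\sum_{i=1}^n\mathbf{1}_{h_i(Y_{1:n})\ne X_i}]$. *)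

(* Defs.v *)
From HB Require Import structures.
From mathcomp Require Import all_boot all_order all_algebra.
From mathcomp Require Import all_classical all_reals all_analysis.

Set Implicit Arguments.
Unset Strict Implicit.
Unset Printing Implicit Defensive.
Import Order.TTheory GRing.Theory Num.Theory.
Local Open Scope classical_set_scope.
Local Open Scope ring_scope.

(* +oo is only the neutral element of the iterated minimum: over a nonempty
   index type the value is the ordinary minimum, see fin_min_le and
   fin_min_attained. *)
Definition fin_min (R : realType) (I : finType) (F : I -> R) : R :=
  fine (\big[Order.min/+oo%E]_(i : I) (F i)%:E).

Section fin_min_theory.
Variables (R : realType) (I : finType) (F : I -> R).

Let m := (\big[Order.min/+oo]_(i : I) (F i)%:E)%E.

Let m_le i : (m <= (F i)%:E)%E.
Proof. by rewrite /m (bigD1 i)//= ge_min lexx. Qed.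

Let m_attained (i : I) : exists j, m = (F j)%:E.
Proof.
have [moo|//] : m = +oo%E \/ exists j, m = (F j)%:E.
  rewrite /m; elim/big_ind : _ => [|x y hx hy|j _]; first by left.
  - by rewrite minEle; case: ifP.
  - by right; exists j.
by have := m_le i; rewrite moo leye_eq.
Qed.

Lemma fin_min_le i : fin_min F <= F i.
Proof.
rewrite /fin_min -/m; have [j mj] := m_attained i.
by have := m_le i; rewrite mj lee_fin.
Qed.

Lemma fin_min_attained (i : I) : exists j, fin_min F = F j.
Proof. by have [j mj] := m_attained i; exists j; rewrite /fin_min -/m mj. Qed.

End fin_min_theory.

(* Separable and completely metrizable: the metric is only required to exist. *)
Definition polish_space (R : realType) (T : topologicalType) : Prop :=
  (exists2 D : set T, countable D & dense D) /\
  exists dist : T -> T -> R,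
    [/\ forall x y, dist x y = 0 <-> x = y,
        forall x y, dist x y = dist y x,
        forall x y z, dist x z <= dist x y + dist y z,
        forall (x : T) (A : set T),
          nbhs x A <-> exists2 e, 0 < e & [set y | dist x y < e] `<=` A &
        forall u : nat -> T,
          (forall e, 0 < e -> exists N, forall m n,
             (N <= m)%N -> (N <= n)%N -> dist (u m) (u n) < e) ->
          exists l : T, u @ \oo --> l].

Notation borel T := (g_sigma_algebraType (@open T)).

(* The label set {1, ..., J} is encoded as 'I_J, with the discrete
   sigma-field: a map into it is measurable when its fibres are. *)
Record hmm_param (R : realType) (J : nat) (d : measure_display)
    (Y : measurableType d) (L : {measure set Y -> \bar R}) := HmmParam {
  init_law : 'rV[R]_J ;
  trans_mx : 'M[R]_J ;
  dens : 'I_J -> Y -> R ;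
  init_law_ge0 : forall x, 0 <= init_law ord0 x ;
  init_law_sum1 : \sum_x init_law ord0 x = 1 ;
  trans_mx_ge0 : forall x x', 0 <= trans_mx x x' ;
  trans_mx_sum1 : forall x, \sum_x' trans_mx x x' = 1 ;
  dens_measurable : forall x, measurable_fun setT (dens x) ;
  dens_ge0 : forall x y, 0 <= dens x y ;
  dens_int1 : forall x, (\int[L]_y (dens x y)%:E = 1)%E
}.

Section hmm.
Context (R : realType) (J : nat) (d : measure_display) (Y : measurableType d).
Context (L : {measure set Y -> \bar R}).
Implicit Type theta : hmm_param J L.

Definition Theta_ind : set (hmm_param J L) :=
  [set theta | forall x, row x (trans_mx theta) = init_law theta].

Definition Theta_dep : set (hmm_param J L) :=
  [set theta | exists x x', row x (trans_mx theta) <> row x' (trans_mx theta)].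

Definition Lambda theta : \bar R :=
  (\int[L]_y (fin_min (fun x0 => \sum_(x | x != x0) dens theta x y))%:E)%E.

Context (d' : measure_display) (Omega : measurableType d').
Context (P : probability Omega R).

Definition sigma_labels (X : nat -> Omega -> 'I_J) : set (set Omega) :=
  <<s [set B | exists i x, B = X i @^-1` [set x]] >>.

(* The law P_theta is represented by an arbitrary probability space carrying
   the chain X and the observations Z.  Times are shifted: index 0 stands for time 1.  In hmm_markov the
   conditional probability of X n.+1 given X 0, ..., X n is cleared of its
   denominator.  hmm_emission states that, for each N, the product of the
   emission probabilities is a version of the conditional probability of
   {Z 0 in A 0, ..., Z N.-1 in A N.-1} given the whole sequence X. *)
Record is_hmm theta (X : nat -> Omega -> 'I_J) (Z : nat -> {RV P >-> Y}) : Prop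
    := IsHmm {
  hmm_labels_measurable : forall i x, measurable (X i @^-1` [set x]) ;
  hmm_init : forall x, P (X 0%N @^-1` [set x]) = (init_law theta ord0 x)%:E ;
  hmm_markov : forall (n : nat) (c : nat -> 'I_J),
    P [set w | forall i, (i <= n.+1)%N -> X i w = c i] =
    (P [set w | forall i, (i <= n)%N -> X i w = c i]
       * (trans_mx theta (c n) (c n.+1))%:E)%E ;
  hmm_emission : forall (N : nat) (A : nat -> set Y) (B : set Omega),
    (forall i, measurable (A i)) -> sigma_labels X B ->
    P (B `&` [set w | forall i, (i < N)%N -> A i (Z i w)]) =
    (\int[P]_(w in B)
       \prod_(i < N) \int[L]_(y in A i) (dens theta (X i w) y)%:E)%E
}.

(* n.-tuple Y carries the product sigma-field. *)
Definition classifiers (n : nat) : set (n.-tuple Y -> n.-tuple 'I_J) :=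
  [set h | forall c, measurable (h @^-1` [set c])].

Definition class_risk (X : nat -> Omega -> 'I_J) (Z : nat -> {RV P >-> Y})
    (n : nat) (h : n.-tuple Y -> n.-tuple 'I_J) : \bar R :=
  'E_P[(fun w => n%:R^-1 * \sum_(i < n)
           (tnth (h [tuple Z i w | i < n]) i != X i w)%:R)%R]%E.

Definition min_class_risk (X : nat -> Omega -> 'I_J)
    (Z : nat -> {RV P >-> Y}) (n : nat) : \bar R :=
  ereal_inf [set class_risk X Z h | h in @classifiers n].

End hmm.

(* Main.v *)
Require Import Defs.
From HB Require Import structures.
From mathcomp Require Import all_boot all_order all_algebra.
From mathcomp Require Import all_classical all_reals all_analysis.
From mathcomp Require Import measurable_realfun simple_functions.
From mathcomp Require Import measurable_fun_approximation ring.
Set Implicit Arguments.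
Unset Strict Implicit.
Unset Printing Implicit Defensive.
Import Order.TTheory GRing.Theory Num.Theory.
Local Open Scope classical_set_scope.
Local Open Scope ring_scope.

(** Fix a site i and the labels at all the other sites, and let lam_x be the
    law of the observations given these labels and the label x at i.  With
    respect to K = sum_x lam_x the law lam_x has density f_x / sum_x' f_x' at
    the i-th observation, and the i-th marginal of K has density sum_x f_x, so
    sum_x lam_x (h <> x) >= Lambda for every classifier h of the site i, even
    one that looks at all the observations.  Moreover the probability of a label
    path is at least kappa times the total probability of the paths that differ
    from it at most at i.  Here kappa = delta for independent labels; in general
    the weight of x at i is a law (>= delta) times a column of Q, whose entries
    lie between delta and 1 - (J - 1) delta, and
    kappa = delta^2 / (1 - (J - 1) delta).
    The upper bound is the error of the classifier that labels each observation
    y by an x0 minimizing sum_(x <> x0) f_x y, because every label has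
    probability at most 1 - (J - 1) delta. *)

(** * Integration against densities, and measures built from densities and images *)

Section density.
Local Open Scope ereal_scope.
Context (R : realType) d1 d2 (T : measurableType d1) (Y : measurableType d2).
Context (mu : {measure set T -> \bar R}) (L : {measure set Y -> \bar R}).
Import HBNNSimple.

(** By monotone convergence along simple approximations of [g], both sides reduce to level sets,
    where the hypothesis on [mu] applies. [D] and [B] allow localization to a box and to one of its
    sides. *)
Lemma ge0_integral_density (phi : T -> Y) (D : set T) (B : set Y)
    (f g : Y -> R) :
  measurable_fun [set: T] phi -> measurable D -> measurable B ->
  measurable_fun [set: Y] f -> (forall y, (0 <= f y)%R) ->
  (forall A, measurable A ->
    mu (D `&` phi @^-1` A) = \int[L]_(y in B `&` A) (f y)%:E) ->
  measurable_fun [set: Y] g -> (forall y, (0 <= g y)%R) ->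
  \int[mu]_(w in D) (g (phi w))%:E = \int[L]_(y in B) (g y * f y)%:E.
Proof.
move=> mphi mD mB mf f0 muE mg g0.
have mgE : measurable_fun [set: Y] (EFin \o g) by exact/measurable_EFinP.
have gE0 y : setT y -> 0 <= (EFin \o g) y by rewrite /= lee_fin.
pose h := nnsfun_approx measurableT mgE.
have hg y : (h n y)%:E @[n --> \oo] --> (g y)%:E.
  exact: (cvg_nnsfun_approx measurableT mgE gE0).
have h_nd y : {homo (fun n => h n y) : n m / (n <= m)%N >-> (n <= m)%R}.
  by move=> n m nm; exact/lefP/nd_nnsfun_approx.
transitivity (limn (fun n => \int[mu]_(w in D) (h n (phi w))%:E)).
  rewrite -monotone_convergence//.
  - by apply: eq_integral => w _; apply/esym/cvg_lim => //; exact: hg.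
  - move=> n; apply/measurable_EFinP/measurable_funTS.
    by apply: measurableT_comp mphi.
  - by move=> n x _; rewrite lee_fin.
  - by move=> x _ n m nm; rewrite lee_fin h_nd.
transitivity (limn (fun n => \int[L]_(y in B) (h n y * f y)%:E)); last first.
  rewrite -monotone_convergence//.
  - apply: eq_integral => y _; apply/cvg_lim => //.
    under eq_fun do rewrite EFinM.
    by rewrite EFinM; apply: cvgeZr.
  - by move=> n; apply/measurable_EFinP/measurable_funTS/measurable_funM.
  - by move=> n x _; rewrite lee_fin mulr_ge0.
  - by move=> x _ n m nm; rewrite lee_fin ler_wpM2r ?h_nd.
congr (limn _); apply/funext => n.
under eq_integral do rewrite fimfunE -fsumEFin//.
have mind r : measurable_fun [set: Y] (\1_(h n @^-1` [set r]) : Y -> R).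
  exact/measurable_indicP.
rewrite ge0_integral_fsum//; last 2 first.
  - move=> r; apply/measurable_EFinP/measurable_funTS.
    by apply: measurable_funM => //; exact: (measurableT_comp (mind r)).
  - by move=> r w _; exact: nnfun_muleindic_ge0.
under [RHS]eq_integral do rewrite fimfunE mulr_fsuml//  -fsumEFin//.
rewrite ge0_integral_fsum//; last 2 first.
  - move=> r; apply/measurable_EFinP/measurable_funTS.
    by apply: measurable_funM => //; exact: measurable_funM.
  - move=> r y _; rewrite EFinM mule_ge0 ?lee_fin//.
    by rewrite -lee_fin; exact: nnfun_muleindic_ge0.
apply: eq_fsbigr => r /[!inE] -[y0 _ hr].
have r0 : (0 <= r)%R by rewrite -hr.
transitivity (r%:E * mu (D `&` phi @^-1` (h n @^-1` [set r]))).
  under eq_integral do rewrite EFinM.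
  rewrite ge0_integralZl//; last first.
    apply/measurable_EFinP/measurable_funTS.
    exact: (measurableT_comp (mind r)).
  congr (_ * _); rewrite setIC -integral_indic//.
  by rewrite -[X in measurable X]setTI; apply: mphi.
rewrite muE//; under [RHS]eq_integral do rewrite -mulrA EFinM.
rewrite [RHS]ge0_integralZl//; last 2 first.
  - by apply/measurable_EFinP/measurable_funTS/measurable_funM.
  - by move=> y _; rewrite lee_fin mulr_ge0.
congr (_ * _); rewrite integral_mkcondr; apply: eq_integral => y _.
by rewrite /patch indicE; case: ifPn => _; rewrite ?mul1r ?mul0r.
Qed.

End density.

Section density_measure.
Local Open Scope ereal_scope.
Context {R : realType} {d} {T : measurableType d}.

Definition density_measure (mu : {measure set T -> \bar R}) {f : T -> \bar R}
    (mf : measurable_fun [set: T] f) (f0 : forall x, 0 <= f x) :=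
  fun A : set T => \int[mu]_(x in A) f x.

Variables (mu : {measure set T -> \bar R}) (f : T -> \bar R).
Hypotheses (mf : measurable_fun [set: T] f) (f0 : forall x, 0 <= f x).
Local Notation fmu := (density_measure mu mf f0).

Let density_measure0 : fmu set0 = 0. Proof. exact: integral_set0. Qed.

Let density_measure_ge0 A : 0 <= fmu A. Proof. exact: integral_ge0. Qed.

Let density_measure_sigma_additive : semi_sigma_additive fmu.
Proof.
move=> F mF tF mUF; rewrite /density_measure ge0_integral_bigcup//; last first.
  exact: measurable_funTS.
by apply: is_cvg_nneseries => n _ _; exact: integral_ge0.
Qed.

HB.instance Definition _ := isMeasure.Build _ _ _ fmu
  density_measure0 density_measure_ge0 density_measure_sigma_additive.

End density_measure.

Section image_measure.
Local Open Scope ereal_scope.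
Context {R : realType} {d1 d2} {T1 : measurableType d1} {T2 : measurableType d2}.

Definition image_measure (mu : {measure set T1 -> \bar R}) {phi : T1 -> T2}
    (mphi : measurable_fun [set: T1] phi) := pushforward mu phi.

Variables (mu : {measure set T1 -> \bar R}) (phi : T1 -> T2).
Hypothesis mphi : measurable_fun [set: T1] phi.

HB.instance Definition _ := Measure.copy (image_measure mu mphi)
  (Measure.clone _ _ _ (pushforward mu phi) 
    (measure_function_pushforward__canonical__measure_function_Measure mu mphi)).

End image_measure.

(** * Boxes as generators of the product sigma-field of tuples *)

Definition box {Y : Type} {n} (A : 'I_n -> set Y) : set (n.-tuple Y) :=
  [set t | forall i, A i (tnth t i)].

Section box.
Context d (Y : measurableType d) (n : nat).
Implicit Types A : 'I_n -> set Y.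

Lemma measurable_box A : (forall i, measurable (A i)) -> measurable (box A).
Proof.
move=> mA.
rewrite (_ : box A = \bigcap_(i in [set: 'I_n]) ((@tnth n Y)^~ i @^-1` A i)).
  apply: fin_bigcap_measurable => // i _; rewrite -[X in measurable X]setTI.
  exact: measurable_tnth.
by apply/seteqP; split=> [t At i _|t At i]; exact: At.
Qed.

Lemma measurable_boxE :
  @measurable _ (n.-tuple Y) =
  <<s [set box A | A in [set A | forall i, measurable (A i)]] >>.
Proof.
apply/seteqP; split; last first.
  apply: smallest_sub; first exact: sigma_algebra_measurable.
  by move=> _ [A mA <-]; exact: measurable_box.
apply: smallest_sub; first exact: smallest_sigma_algebra.
case: n => [|k]; first by rewrite big_ord0.
rewrite -bigcup_mkord_ord; apply: bigcup_sub => i Ii B [C mC <-].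
apply: sub_sigma_algebra.
(* A coordinate cylinder is the box with side [C] at that coordinate and full sides elsewhere. *)
exists (fun j => if j == inord i then C else setT) => [j|].
  by case: ifP.
rewrite setTI; apply/seteqP; split => [t /(_ (inord i))|t Ct j].
  by rewrite eqxx.
by case: eqP => // ->.
Qed.

(** Boxes generate, are stable under intersection and include the whole space, where [m1] is finite,
    so the uniqueness theorem for measures applies. *)
Lemma measure_unique_box (R : realType) (m1 m2 : {measure set (n.-tuple Y) -> \bar R}) :
  (m1 setT < +oo)%E ->
  (forall A, (forall i, measurable (A i)) -> m1 (box A) = m2 (box A)) ->
  forall S, measurable S -> m1 S = m2 S.
Proof.
move=> m1oo m12.
apply: (measure_unique _ (fun=> setT) measurable_boxE) => //.
- move=> _ _ [A mA <-] [B mB <-]; exists (fun i => A i `&` B i).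
    by move=> i; exact: measurableI.
  apply/seteqP; split=> [t AB|t [At Bt] i]; last by split.
  by split=> i; have [] := AB i.
- by move=> _; exists (fun=> setT) => //; apply/seteqP; split.
- by rewrite bigcup_const//; exists 0%N.
- by move=> _ [A mA <-]; exact: m12.
Qed.

End box.

Section fin_min_measurable.
Context (R : realType) d (T : measurableType d) (I : finType).

Lemma measurable_fin_min (F : I -> T -> R) :
  (forall i, measurable_fun [set: T] (F i)) ->
  measurable_fun [set: T] (fun t => fin_min (F ^~ t)).
Proof.
move=> mF; rewrite /fin_min.
have mbig : measurable_fun [set: T]
    (fun t => \big[Order.min/+oo%E]_(i : I) (F i t)%:E).
  elim: (index_enum I) => [|i s ih].
    by under eq_fun do rewrite big_nil; exact: measurable_cst.
  under eq_fun do rewrite big_cons.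
  by apply: measurable_mine ih; exact/measurable_EFinP.
by apply: measurableT_comp mbig; exact: fine_measurable.
Qed.

End fin_min_measurable.

(** * Bayes bound at one site, for laws that differ only in the emission there *)

Section posterior.
Local Open Scope ereal_scope.
Context (R : realType) (J n : nat) d (Y : measurableType d).
Context (L : {measure set Y -> \bar R}).
Variable f : 'I_J -> Y -> R.
Hypotheses (mf : forall x, measurable_fun [set: Y] (f x))
  (f0 : forall x y, (0 <= f x y)%R).
Variables (x0 : 'I_J) (i : 'I_n) (C : ('I_n -> set Y) -> R).
Hypotheses (C0 : forall A, (0 <= C A)%R) (CT : C (fun=> setT) = 1%R)
  (Cupd : forall A B, C (fun j => if j == i then B else A j) = C A).
Variable lam : 'I_J -> {measure set (n.-tuple Y) -> \bar R}.
Hypotheses (lam_fin : forall x, lam x setT < +oo)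
  (lam_box : forall x A, (forall j, measurable (A j)) ->
     lam x (box A) = (C A)%:E * \int[L]_(y in A i) (f x y)%:E).

Let m y : R := \sum_x f x y.
Let r x y : R := f x y / m y.

Let f_le_m x y : (f x y <= m y)%R.
Proof. by rewrite /m (bigD1 x)//= lerDl sumr_ge0. Qed.

Let m0 y : (0 <= m y)%R. Proof. exact: sumr_ge0. Qed.

Let mm : measurable_fun [set: Y] m.
Proof. exact: measurable_sum. Qed.

Let r0 x y : (0 <= r x y)%R. Proof. by rewrite divr_ge0. Qed.

Let minv : measurable_fun [set: Y] (fun y => (m y)^-1%R).
Proof.
under eq_fun do rewrite -powR_inv1//.
exact: (measurableT_comp (measurable_powR (R := R) (-1)) mm).
Qed.

Let mr x : measurable_fun [set: Y] (r x).
Proof. exact: measurable_funM. Qed.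

(** Where [m] vanishes so does every [f x], so the convention that division by zero gives zero does
    no harm. *)
Let rM x y : (r x y * m y = f x y)%R.
Proof.
rewrite /r; have [my0|my0] := eqVneq (m y) 0%R; last by rewrite divfK.
by rewrite my0 mulr0; apply/eqP; rewrite eq_le f0/= -my0 f_le_m.
Qed.

(** [C A] stands for the contribution of the sites other than [i]; by [Cupd] it ignores the side at
    [i]. Shrinking that side shows that, on the box, coordinate [i] has density [C A * f x] under
    [lam x]. *)
Let integral_coord_box x A (g : Y -> R) : (forall j, measurable (A j)) ->
  measurable_fun [set: Y] g -> (forall y, (0 <= g y)%R) ->
  \int[lam x]_(t in box A) (g (tnth t i))%:E =
  (C A)%:E * \int[L]_(y in A i) (g y * f x y)%:E.
Proof.
move=> mA mg g0.
rewrite (@ge0_integral_density _ _ _ _ _ _ L _ _ (A i) (fun y => C A * f x y)%R)//.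
- under eq_integral do rewrite mulrCA EFinM.
  rewrite ge0_integralZl//.
  + exact/measurable_EFinP/measurable_funTS/measurable_funM.
  + by move=> y _; rewrite lee_fin mulr_ge0.
  + by rewrite lee_fin.
- exact: measurable_tnth.
- exact: measurable_box.
- exact: measurable_funM.
- by move=> y; exact: mulr_ge0.
move=> B mB; pose AB j := if j == i then A i `&` B else A j.
rewrite (_ : _ `&` _ = box AB); last first.
  apply/seteqP; split=> [t [At Bt] j|t ABt].
    rewrite /AB; case: eqP => [->|_]; last exact: At.
    by split; [exact: At|].
  split=> [j|]; last by have := ABt i; rewrite /AB eqxx => -[].
  by have := ABt j; rewrite /AB; case: eqP => [-> []|].
rewrite lam_box; last by move=> j; rewrite /AB; case: ifP => // _; exact: measurableI.
rewrite Cupd {1}/AB eqxx; under [RHS]eq_integral do rewrite EFinM.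
rewrite ge0_integralZl//; [exact: measurableI|
  exact/measurable_EFinP/measurable_funTS| |by rewrite lee_fin].
by move=> y _; rewrite lee_fin.
Qed.

(** [msum] is indexed by natural numbers, so labels are read off [enum 'I_J]; [x0] is the default of
    [nth], never reached at indices below [J]. *)
Let K : {measure set (n.-tuple Y) -> \bar R} :=
  msum (fun k => lam (nth x0 (enum 'I_J) k)) J.

Let integralK D (g : n.-tuple Y -> R) : measurable D -> 
  measurable_fun [set: n.-tuple Y] g -> (forall y, (0 <= g y)%R) ->
  \int[K]_(t in D) (g t)%:E = \sum_x \int[lam x]_(t in D) (g t)%:E.
Proof.
move=> mD mg g0; rewrite /K/= ge0_integral_measure_sum//.
- by apply: eq_bigr => x _; rewrite nth_ord_enum.
- by move=> t _; rewrite lee_fin.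
- exact/measurable_EFinP/measurable_funTS.
Qed.

Let mcoord (g : Y -> R) : measurable_fun [set: Y] g ->
  measurable_fun [set: n.-tuple Y] (fun t => g (tnth t i)).
Proof. by move=> mg; apply: (measurableT_comp mg); exact: measurable_tnth. Qed.

(* Bayes: with respect to K, the density of lam x is the posterior weight of x
   given the observation at i. *)
Let lam_posterior x S : measurable S ->
  lam x S = \int[K]_(t in S) (r x (tnth t i))%:E.
Proof.
have mrE : measurable_fun [set: n.-tuple Y] (fun t => (r x (tnth t i))%:E).
  by apply/measurable_EFinP; exact: mcoord (mr x).
have rE0 (t : n.-tuple Y) : 0 <= (r x (tnth t i))%:E by rewrite lee_fin.
(* The right side is a measure in [S] too, so it is enough to compare the two on boxes. *)
move: S; suff boxE (A : 'I_n -> set Y) : (forall j, measurable (A j)) ->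
    lam x (box A) = density_measure K mrE rE0 (box A).
  exact: (measure_unique_box (lam_fin x) boxE).
move=> mA; rewrite /density_measure integralK//; last 2 first.
  exact: measurable_box.
  exact: mcoord.
under eq_bigr do rewrite integral_coord_box//.
rewrite -ge0_sume_distrr; last first.
  by move=> y _; apply: integral_ge0 => *; rewrite lee_fin mulr_ge0.
rewrite lam_box// -ge0_integral_sum//.
- congr (_ * _); apply: eq_integral => y _.
  by rewrite sumEFin -mulr_sumr rM.
- move=> x'; exact/measurable_EFinP/measurable_funTS/measurable_funM.
- by move=> x' y _; rewrite lee_fin mulr_ge0.
Qed.

(** Both sides are integrals against [K]. Its marginal at [i] has density [m], so the left side
    integrates [emin / m] at that coordinate; the right side integrates the posterior weights of the
    labels other than [h t], whose sum is pointwise at least as large. *)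
Lemma integral_fin_min_le_error (h : n.-tuple Y -> 'I_J) :
  (forall x, measurable (h @^-1` [set x])) ->
  \int[L]_y (fin_min (fun x0 => \sum_(x | x != x0) f x y)%R)%:E <=
  \sum_x lam x [set t | h t != x].
Proof.
move=> mh.
pose emin y := fin_min (fun x0 => \sum_(x | x != x0) f x y)%R.
pose g y := (emin y / m y)%R.
have mmin : measurable_fun [set: Y] emin.
  apply: measurable_fin_min => x; under eq_fun do rewrite big_mkcond.
  by apply: measurable_sum => x'; case: (x' != x).
have min0 y : (0 <= emin y)%R.
  rewrite /emin.
  have [j ->] := fin_min_attained (fun x0 => \sum_(x | x != x0) f x y)%R x0.
  exact: sumr_ge0.
have mg : measurable_fun [set: Y] g by exact: measurable_funM.
have g0 y : (0 <= g y)%R by rewrite divr_ge0.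
have mhx x : measurable [set t | h t != x].
  rewrite (_ : [set t | _] = ~` (h @^-1` [set x])); first exact: measurableC.
  by apply/seteqP; split=> t /= /eqP.
have mrh x : measurable_fun [set: n.-tuple Y]
    ((fun t => (r x (tnth t i))%:E) \_ [set t | h t != x]).
  apply/(measurable_restrictT _ (mhx x)).
  by apply/measurable_EFinP/measurable_funTS; exact: (mcoord (mr x)).
have -> : \int[L]_y (emin y)%:E =
    \int[K]_t (g (tnth t i))%:E.
  rewrite integralK//; last exact: mcoord.
  have bT : setT = box (fun=> setT) :> set (n.-tuple Y) by apply/seteqP; split.
  under eq_bigr do rewrite bT integral_coord_box// CT mul1e.
  rewrite -ge0_integral_sum//.
  - apply: eq_integral => y _; rewrite sumEFin -mulr_sumr -/(m y) /g.
    have [my0|my0] := eqVneq (m y) 0%R; last by rewrite divfK.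
    (* At a zero of [m] the minimum is zero as well, being at most the sum without [x0], hence at
       most [m y]. *)
    rewrite my0 mulr0; congr (_%:E); apply/eqP; rewrite eq_le min0 andbT.
    rewrite -my0 /m [leRHS](bigD1 x0)//=; apply: ler_wpDl; first exact: f0.
    exact: fin_min_le.
  - by move=> x; exact/measurable_EFinP/measurable_funM.
  - by move=> x y _; rewrite lee_fin mulr_ge0.
under eq_bigr do rewrite lam_posterior// integral_mkcond.
rewrite -ge0_integral_sum//; last first.
  by move=> x t _; rewrite erestrict_ge0// => *; rewrite lee_fin.
apply: ge0_le_integral => //.
- by move=> t _; rewrite lee_fin.
- by apply/measurable_EFinP; exact: mcoord.
- exact: (emeasurable_sum (index_enum _) mrh).
(* The label [h t] is one of the candidates over which the minimum is taken. *)
move=> t _; rewrite (eq_bigr (fun x => (if x != h t then r x (tnth t i) else 0%R)%:E)).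
  rewrite sumEFin lee_fin -big_mkcond/= /r /g -mulr_suml.
  by rewrite ler_wpM2r ?invr_ge0//; exact: fin_min_le.
move=> x _; rewrite /patch eq_sym; case: ifP => [|/negP]; rewrite inE/=; first by move=> ->.
by move=> /negP; case: ifP.
Qed.

End posterior.

(** * Paths changed at one site, and decompositions over fibres *)

Definition update {T : Type} (c : nat -> T) (i : nat) (x : T) : nat -> T :=
  fun j => if j == i then x else c j.

(** Each path arises exactly once by resetting the label at [i] in a path with label [x0] there;
    [x0] selects a representative of each class of paths that agree off [i]. *)
Lemma bigD1_update (I : finType) (n : nat) (i : 'I_n) (x0 : I) (V : nmodType)
    (F : {ffun 'I_n -> I} -> V) :
  \sum_(c : {ffun 'I_n -> I}) F c =
  \sum_(c : {ffun 'I_n -> I} | c i == x0) \sum_x F [ffun j => if j == i then x else c j].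
Proof.
pose u (c : {ffun 'I_n -> I}) x := [ffun j => if j == i then x else c j].
have uE c x j : u c x j = if j == i then x else c j by rewrite ffunE.
rewrite (partition_big (fun c => u c x0) (fun c => c i == x0)) /=; last first.
  by move=> c _; rewrite uE eqxx.
apply: eq_bigr => c /eqP ci.
rewrite (reindex_onto (u c) (fun c' => c' i)) /=; last first.
  move=> c' /eqP <-; apply/ffunP => j; rewrite !uE.
  by case: eqP => // ->.
apply: eq_bigl => x; rewrite uE !eqxx andbT; apply/eqP/ffunP => j.
by rewrite !uE; case: eqP => // ->.
Qed.

Lemma measurable_fiber_neq d (T : measurableType d) (I : finType) (g h : T -> I) :
  (forall i, measurable (g @^-1` [set i])) ->
  (forall i, measurable (h @^-1` [set i])) -> measurable [set t | g t != h t].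
Proof.
move=> mg mh; rewrite (_ : [set t | _] = \bigcup_(i in [set: I])
    (h @^-1` [set i] `&` ~` (g @^-1` [set i]))); last first.
  apply/seteqP; split=> [t /eqP gh|t [i _ [/= <- /eqP]]//].
  by exists (h t).
by apply: fin_bigcup_measurable => // i _; apply: measurableI => //; exact: measurableC.
Qed.

Section partition.
Context (R : realType) d (T : measurableType d) (P : probability T R).

Lemma probability_fibers (I : finType) (g : T -> I) (A : set T) :
  (forall i, measurable (g @^-1` [set i])) -> measurable A ->
  (P A = \sum_i P (g @^-1` [set i] `&` A))%E.
Proof.
move=> mg mA.
rewrite [RHS]fsbig_seq ?index_enum_uniq//= (_ : [set` index_enum I] = setT); last first.
  by apply/seteqP; split=> // i _ /=; exact: mem_index_enum.
rewrite -measure_fin_bigcup//; last 2 first.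
- apply/trivIsetP => i j _ _ /eqP ij; apply/seteqP; split=> // w [[gi _] [gj _]].
  by apply: ij; rewrite -gi -gj.
- by move=> i _; exact: measurableI.
- by congr (P _); apply/seteqP; split=> [w Aw|w [i _ []]//]; exists (g w).
- exact: finite_finset.
Qed.

End partition.

(** * Weights of label paths and their variation at one site *)

Section path_weight.
Context (R : realType) (J : nat) d (Y : measurableType d).
Context (L : {measure set Y -> \bar R}) (theta : hmm_param J L).
Local Notation Q := (trans_mx theta).
Local Notation nu := (init_law theta ord0).

(** The probability of the labels [c 0], ..., [c n]; [n] counts transitions, so [n.+1] labels
    enter. *)
Definition path_weight (n : nat) (c : nat -> 'I_J) : R :=
  nu (c 0%N) * \prod_(k < n) Q (c k) (c k.+1).

Lemma path_weightS n c :
  path_weight n.+1 c = path_weight n c * Q (c n) (c n.+1).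
Proof. by rewrite /path_weight big_ord_recr/= mulrA. Qed.

Lemma eq_path_weight n c c' : (forall k, (k <= n)%N -> c k = c' k) ->
  path_weight n c = path_weight n c'.
Proof.
move=> cc'; rewrite /path_weight cc'//; congr (_ * _); apply: eq_bigr => k _.
by rewrite !cc'// ltnW.
Qed.

(** The label at [i] enters only the incoming factor, from the initial law or a row of [Q], and the
    outgoing factor [Q x z], absent at the last site; [G] gathers the rest. *)
Lemma path_weight_update n c i : (i <= n)%N ->
  exists G l z, [/\ 0 <= G,
    l = nu \/ (exists y, l = Q y) &
    forall x, path_weight n (update c i x) =
              G * l x * (if i == n then 1 else Q x z)].
Proof.
elim: n => [|n IH].
  rewrite leqn0 => /eqP ->; exists 1, nu, (c 0%N); split=> //; first by left.
  by move=> x; rewrite /path_weight big_ord0 /update /= mul1r.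
rewrite leq_eqVlt => /predU1P[->|].
  exists (path_weight n c), (Q (c n)), (c n); split.
  - apply: mulr_ge0; first exact: init_law_ge0.
    by apply: prodr_ge0 => *; exact: trans_mx_ge0.
  - by right; exists (c n).
  move=> x; rewrite path_weightS eqxx mulr1 /update eqxx ltn_eqF//; congr (_ * _).
  by apply: eq_path_weight => k kn; rewrite ltn_eqF.
rewrite ltnS => ilen; have [G [l [z [G0 hl wE]]]] := IH ilen.
move: ilen; rewrite leq_eqVlt => /predU1P[iE|ltin].
  exists G, l, (c n.+1); split=> // x.
  rewrite path_weightS wE iE eqxx mulr1 ltn_eqF// /update eqxx.
  by rewrite gtn_eqF.
exists (G * Q (c n) (c n.+1)), l, z; split=> //.
  by rewrite mulr_ge0// trans_mx_ge0.
move=> x; rewrite path_weightS wE (ltn_eqF ltin) (ltn_eqF (leqW ltin)).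
rewrite /update (gtn_eqF ltin) (gtn_eqF (leqW ltin)); ring.
Qed.

Variables (delta : R) (hdelta : 0 < delta).
Hypotheses (Qdelta : forall x y, delta <= Q x y) (nudelta : forall x, delta <= nu x).
Local Notation q := (1 - (J%:R - 1) * delta).

(** The other [J.-1] entries already take up at least [delta] each. *)
Lemma stochastic_le (p : 'I_J -> R) (x : 'I_J) :
  \sum_y p y = 1 -> (forall y, delta <= p y) -> p x <= q.
Proof.
move=> p1 pd; have J1 : (J.-1)%:R = J%:R - 1 :> R.
  by case: J x {p1 pd} => [[]//|k] _; rewrite -natr1 addrK.
have le_rest : (J.-1)%:R * delta <= \sum_(y | y != x) p y.
  rewrite mulr_natl (_ : delta *+ J.-1 = \sum_(y | y != x) delta).
    by apply: ler_sum.
  by rewrite sumr_const cardC1 card_ord.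
by move: p1; rewrite (bigD1 x)//= => p1; rewrite -J1 lerBrDr -[leRHS]p1 lerD2l.
Qed.

Let sum_law l : l = nu \/ (exists y, l = Q y) -> \sum_x l x = 1.
Proof. by case=> [->|[y ->]]; [exact: init_law_sum1|exact: trans_mx_sum1]. Qed.

Let law_ge l : l = nu \/ (exists y, l = Q y) -> forall x, delta <= l x.
Proof. by case=> [->|[y ->]]. Qed.

Lemma path_weight_gt0 n c : 0 < path_weight n c.
Proof.
apply: mulr_gt0; first exact: lt_le_trans (nudelta _).
by apply: prodr_gt0 => k _; exact: lt_le_trans (Qdelta _ _).
Qed.

(** With equal rows the outgoing factor is [nu z] whatever the label at [i], so the share of [x] is
    [l x], which is at least [delta]. *)
Lemma path_weight_share_ind n c i x : Theta_ind theta -> (i <= n)%N ->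
  delta * \sum_x' path_weight n (update c i x') <= path_weight n (update c i x).
Proof.
move=> ind ilen; have [G [l [z [G0 hl wE]]]] := path_weight_update c ilen.
have [r r0 {}wE] : exists2 r, 0 <= r & forall x, path_weight n (update c i x) = G * l x * r.
  exists (if i == n then 1 else nu z) => [|y].
    by case: ifP => // _; exact: init_law_ge0.
  rewrite wE; case: ifP => // _; congr (_ * _).
  by have /rowP/(_ z) := ind y; rewrite mxE.
under eq_bigr do rewrite wE.
rewrite wE -mulr_suml -mulr_sumr (sum_law hl) mulr1 mulrA ler_wpM2r// mulrC.
by rewrite ler_wpM2l// law_ge.
Qed.

(** The share of [x] is [l x * r x] over the sum of all [l y * r y]. Here [l x >= delta], the sum is
    at most a common bound [b] of the [r y] because [l] has total one, and
    [delta / q <= r x / b]. *)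
Lemma path_weight_share n c i x : (i <= n)%N ->
  delta ^+ 2 / q * \sum_x' path_weight n (update c i x') <=
  path_weight n (update c i x).
Proof.
move=> ilen; have [G [l [z [G0 hl wE]]]] := path_weight_update c ilen.
have dq : delta <= q by rewrite (le_trans (nudelta x))// stochastic_le// init_law_sum1.
have q0 : 0 < q by exact: lt_le_trans dq.
pose r y := if i == n then 1 else Q y z.
(* At the last site [r] is constantly 1 and [delta <= q] is enough; elsewhere [b = q] bounds the
   column, and [r x >= delta]. *)
have [b b0 [rb br]] : exists2 b, 0 < b & (forall y, r y <= b) /\ delta * b <= q * r x.
  rewrite /r; case: ifP => _.
    by exists 1 => //; split=> //; rewrite !mulr1.
  exists q => //; split=> [y|].
    by apply: stochastic_le => //; exact: trans_mx_sum1.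
  by rewrite mulrC ler_wpM2l// ltW.
rewrite mulrAC ler_pdivrMr//.
have le_s : \sum_x' path_weight n (update c i x') <= G * b.
  under eq_bigr do rewrite wE.
  rewrite (le_trans (y := \sum_y G * l y * b))//; last first.
    by rewrite -mulr_suml -mulr_sumr (sum_law hl) mulr1.
  apply: ler_sum => y _; rewrite ler_wpM2l//; last exact: rb.
  by rewrite mulr_ge0// (le_trans (ltW hdelta))// law_ge.
rewrite (le_trans (ler_wpM2l _ le_s)) ?exprn_ge0 ?(ltW hdelta)//.
rewrite wE -/(r x).
have -> : delta ^+ 2 * (G * b) = G * delta * (delta * b) by ring.
have -> : G * l x * r x * q = G * l x * (q * r x) by ring.
rewrite ler_pM//.
- by rewrite mulr_ge0// ltW.
- by rewrite mulr_ge0// ltW.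
- by rewrite ler_wpM2l// law_ge.
Qed.

End path_weight.

(** * Joint law of label paths and observations; lower bound at one site *)

Section hmm_paths.
Context (R : realType) (J : nat) d (Y : measurableType d).
Context (L : {measure set Y -> \bar R}) (theta : hmm_param J L).
Context d' (Omega : measurableType d') (P : probability Omega R).
Context (X : nat -> Omega -> 'I_J) (Z : nat -> {RV P >-> Y}).
Hypothesis hXZ : is_hmm theta X Z.
Local Notation f := (dens theta).

Definition path_event (n : nat) (c : nat -> 'I_J) : set Omega :=
  [set w | forall i, (i <= n)%N -> X i w = c i].

Lemma eq_path_event n c c' : (forall k, (k <= n)%N -> c k = c' k) ->
  path_event n c = path_event n c'.
Proof.
by move=> cc'; apply/seteqP; split=> w wc k kn; rewrite wc// cc'.
Qed.

Lemma path_event0 c : path_event 0 c = X 0%N @^-1` [set c 0%N].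
Proof.
apply/seteqP; split=> [w|w wc i]; first exact.
by rewrite leqn0 => /eqP ->.
Qed.

Lemma path_eventS n c :
  path_event n.+1 c = path_event n c `&` X n.+1 @^-1` [set c n.+1].
Proof.
apply/seteqP; split=> [w wc|w [wc wS] i].
  by split=> [i iin|]; apply: wc => //; exact: leqW.
by rewrite leq_eqVlt => /predU1P[->//|]; exact: wc.
Qed.

Lemma probability_path_event n c :
  P (path_event n c) = (path_weight theta n c)%:E.
Proof.
elim: n => [|n IH].
  by rewrite path_event0 (hmm_init hXZ) /path_weight big_ord0 mulr1.
by rewrite /path_event (hmm_markov hXZ) -/(path_event n c) IH path_weightS EFinM.
Qed.

(** Makes path events admissible as the set [B] of [hmm_emission]. *)
Lemma sigma_labels_path_event n c : sigma_labels X (path_event n c).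
Proof.
pose G := [set B | exists i x, B = X i @^-1` [set x]].
have mX i x : @measurable _ (g_sigma_algebraType G) (X i @^-1` [set x]).
  by apply: sub_sigma_algebra; exists i, x.
elim: n => [|n IH]; first by rewrite path_event0; exact: mX.
rewrite path_eventS; apply: (@measurableI _ (g_sigma_algebraType G)) => //.
Qed.

Lemma measurable_path_event n c : measurable (path_event n c).
Proof.
elim: n => [|n IH]; first by rewrite path_event0; exact: (hmm_labels_measurable hXZ).
by rewrite path_eventS; apply: measurableI => //; exact: (hmm_labels_measurable hXZ).
Qed.

Definition observations n (w : Omega) : n.-tuple Y := [tuple Z i w | i < n].

Lemma measurable_observations n : measurable_fun [set: Omega] (observations n).
Proof.
apply/measurable_fun_tnthP => i; rewrite (_ : _ \o _ = Z i)//.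
by apply/funext => w; rewrite /= tnth_mktuple.
Qed.

(** On a path event the product of emission probabilities is constant, so the integral in
    [hmm_emission] is that constant times the path probability. *)
Lemma emission_box m c (A : 'I_m.+1 -> set Y) : (forall j, measurable (A j)) ->
  P (path_event m c `&` observations m.+1 @^-1` box A) =
  ((path_weight theta m c)%:E * \prod_(j < m.+1) \int[L]_(y in A j) (f (c j) y)%:E)%E.
Proof.
move=> mA.
have := hmm_emission hXZ m.+1 (A := fun k => A (inord k)) (fun k => mA _)
  (sigma_labels_path_event m c).
rewrite (_ : [set w | _] = observations m.+1 @^-1` box A); last first.
  apply/seteqP; split=> w Aw i.
    by have := Aw i (ltn_ord i); rewrite inord_val tnth_mktuple.
  by move=> im; have := Aw (inord i); rewrite tnth_mktuple inordK.
move=> ->.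
rewrite (eq_integral (cst (\prod_(j < m.+1) \int[L]_(y in A j) (f (c j) y)%:E)))%E.
  rewrite integral_cst; last exact: measurable_path_event.
  by rewrite muleC; congr (_ * _)%E; exact: probability_path_event.
move=> w /[!inE] wc; apply: eq_bigr => j _; rewrite inord_val.
by rewrite wc// -ltnS.
Qed.

Lemma dens_integral_ge0 x A : (0 <= \int[L]_(y in A) (f x y)%:E)%E.
Proof. by apply: integral_ge0 => y _; rewrite lee_fin dens_ge0. Qed.

Lemma dens_integral_fin x A : measurable A ->
  (\int[L]_(y in A) (f x y)%:E)%E \is a fin_num.
Proof.
move=> mA; rewrite ge0_fin_numE ?dens_integral_ge0//.
apply: (@le_lt_trans _ _ 1%E); last by rewrite ltry.
rewrite -(dens_int1 theta x); apply: ge0_subset_integral => //.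
- by apply/measurable_EFinP; exact: dens_measurable.
- by move=> y _; rewrite lee_fin dens_ge0.
Qed.

Local Notation W m := (observations m.+1).
(** Finite functions make the paths a finite type to sum over. [inord] extends them to all times,
    and only the times up to [m] matter. *)
Definition path_of m (c : {ffun 'I_m.+1 -> 'I_J}) (j : nat) : 'I_J := c (inord j).

Lemma path_event_ffun m (c : {ffun 'I_m.+1 -> 'I_J}) :
  path_event m (path_of c) =
  (fun w => [ffun j : 'I_m.+1 => X j w]) @^-1` [set c].
Proof.
apply/seteqP; split=> w.
  move=> wc; apply/ffunP => j; rewrite ffunE wc ?/path_of ?inord_val//.
  by rewrite -ltnS.
by move=> /= <- k km; rewrite /path_of ffunE inordK.
Qed.

Lemma sum_path_weight m :
  \sum_(c : {ffun 'I_m.+1 -> 'I_J}) path_weight theta m (path_of c) = 1.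
Proof.
apply: EFin_inj; rewrite -sumEFin -(probability_setT P).
rewrite (probability_fibers P (g := fun w => [ffun j : 'I_m.+1 => X j w]))//.
  apply: eq_bigr => c _.
  by rewrite setIT -path_event_ffun; exact/esym/probability_path_event.
by move=> c; rewrite -path_event_ffun; exact: measurable_path_event.
Qed.

Lemma measurable_error m (i : 'I_m.+1) (h : m.+1.-tuple Y -> 'I_J) :
  (forall x, measurable (h @^-1` [set x])) ->
  measurable [set w | h (W m w) != X i w].
Proof.
move=> mh; apply: measurable_fiber_neq => x; last exact: (hmm_labels_measurable hXZ).
rewrite (_ : _ @^-1` _ = W m @^-1` (h @^-1` [set x]))//.
by rewrite -[X in measurable X]setTI; exact: measurable_observations.
Qed.

(** The error event is split over label paths, grouped by their labels off [i]. Within a group the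
    laws of the observations given the paths differ only in the emission at [i], so
    [integral_fin_min_le_error] applies to them, and [share] bounds each path weight below by
    [kappa] times the group total. *)
Lemma site_error_ge m (i : 'I_m.+1) (h : m.+1.-tuple Y -> 'I_J) (kappa : R)
    (x0 : 'I_J) :
  (forall x, measurable (h @^-1` [set x])) -> 0 <= kappa ->
  (forall c, 0 < path_weight theta m c) ->
  (forall c x, kappa * \sum_x' path_weight theta m (update c i x') <=
     path_weight theta m (update c i x)) ->
  (kappa%:E * Lambda theta <= P [set w | h (W m w) != X i w])%E.
Proof.
move=> mh k0 w0 share.
have mhx x : measurable [set t | h t != x].
  rewrite (_ : [set t | _] = ~` (h @^-1` [set x])); first exact: measurableC.
  by apply/seteqP; split=> t /= /eqP.
have L0 : (0 <= Lambda theta)%E.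
  apply: integral_ge0 => y _; rewrite lee_fin.
  have [j ->] := fin_min_attained (fun x0 => \sum_(x | x != x0) f x y) x0.
  by apply: sumr_ge0 => *; exact: dens_ge0.
have -> : (P [set w | h (W m w) != X i w] = \sum_(c : {ffun 'I_m.+1 -> 'I_J})
    P (path_event m (path_of c) `&` W m @^-1` [set t | h t != c i]))%E.
  rewrite (probability_fibers P (g := fun w => [ffun j : 'I_m.+1 => X j w])).
  - apply: eq_bigr => c _; rewrite path_event_ffun; congr (P _); apply/seteqP.
    by split=> w [/= <-]; rewrite ffunE.
  - by move=> c; rewrite -path_event_ffun; exact: measurable_path_event.
  - exact: measurable_error.
rewrite (bigD1_update i x0).
pose wt (c : {ffun 'I_m.+1 -> 'I_J}) x := path_weight theta m (update (path_of c) i x).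
have wt0 c x : 0 <= wt c x by exact/ltW/w0.
have pathE (c : {ffun 'I_m.+1 -> 'I_J}) x k : (k <= m)%N ->
  path_of [ffun j => if j == i then x else c j] k = update (path_of c) i x k.
  by move=> km; rewrite /path_of /update ffunE -val_eqE/= inordK.
(* The group totals add up to one, which distributes [Lambda theta] over the groups. *)
have le1 : (kappa%:E * Lambda theta <=
    \sum_(c : {ffun 'I_m.+1 -> 'I_J} | c i == x0)
    (kappa * (\sum_x wt c x)%R)%:E * Lambda theta)%E.
  rewrite -ge0_sume_distrl; last first.
    move=> c _; rewrite lee_fin mulr_ge0//; exact: sumr_ge0.
  rewrite sumEFin -mulr_sumr.
  have : \sum_(c : {ffun 'I_m.+1 -> 'I_J} | c i == x0) \sum_x wt c x = 1.
    rewrite -(sum_path_weight m) (bigD1_update i x0).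
    apply: eq_bigr => c _; apply: eq_bigr => x _; apply: eq_path_weight => k km.
    by rewrite pathE.
  by move=> ->; rewrite mulr1.
apply: (le_trans le1); apply: lee_sum => c _.
pose E x := path_event m (update (path_of c) i x).
have mE x : measurable (E x) by exact: measurable_path_event.
(* The law of the observations given the path: restriction to the path event, image by the
   observations, division by the positive path weight. *)
pose lam x : {measure set (m.+1.-tuple Y) -> \bar R} :=
  mscale (NngNum (ltW (etrans (invr_gt0 _) (w0 (update (path_of c) i x)))))
    (image_measure (mrestr P (mE x)) (@measurable_observations m.+1)).
have lamE x S : lam x S = ((wt c x)^-1%:E * P (E x `&` W m @^-1` S))%E.
  by rewrite /lam/= /mscale/= /image_measure /pushforward /mrestr setIC.
apply: (@le_trans _ _ (\sum_x (kappa * (\sum_x wt c x)%R)%:E * lam x [set t | h t != x])%E).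
  rewrite -ge0_sume_distrr//; apply: lee_pmul => //.
    by rewrite lee_fin mulr_ge0//; exact: sumr_ge0.
  pose C (A : 'I_m.+1 -> set Y) : \bar R :=
    (\prod_(j < m.+1 | j != i) \int[L]_(y in A j) (f (path_of c j) y)%:E)%E.
  have C0 A : (0 <= C A)%E by apply: prode_ge0 => j _; exact: dens_integral_ge0.
  have Cfin A : (forall j, measurable (A j)) -> C A \is a fin_num.
    move=> mA; rewrite /C; apply: (big_ind (fun x => x \is a fin_num)) => //.
      by move=> *; exact: fin_numM.
    by move=> j _; exact: dens_integral_fin.
  apply: (@integral_fin_min_le_error _ _ _ _ _ _ _ (dens_measurable theta)
    (dens_ge0 theta) x0 i (fun A => fine (C A))) => //.
  - by move=> A; exact: fine_ge0.
  - by rewrite /C big1// => j _; exact: dens_int1.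
  - move=> A B; congr (fine _); apply: eq_bigr => j /negPf ji.
    by rewrite ji.
  - move=> x; rewrite lamE preimage_setT setIT.
    by rewrite -ge0_fin_numE ?fin_numM ?mule_ge0// ?fin_num_measure// lee_fin invr_ge0.
  move=> x A mA; rewrite lamE emission_box// fineK ?Cfin//.
  rewrite -/(wt c x) muleA -EFinM mulVf ?gt_eqF// ?mul1e; last exact: w0.
  rewrite (bigD1 i)//= muleC /update eqxx; congr (_ * _)%E.
  by apply: eq_bigr => j ji; rewrite val_eqE (negPf ji).
(* The inequality left after cancelling is [share]: [kappa] times the group total, divided by the
   weight of the path through [x], is at most one. *)
apply: lee_sum => x _; rewrite lamE ffunE eqxx muleA -EFinM.
rewrite (eq_path_event (c' := update (path_of c) i x)); last by move=> *; exact: pathE.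
rewrite -/(E x) -[leRHS]mul1e; apply: lee_wpmul2r => //.
by rewrite lee_fin ler_pdivrMr ?mul1r; [exact: share|exact: w0].
Qed.


End hmm_paths.

(** * Measurable selection of a minimizing index *)

Lemma measurable_fiber_comp d (T : measurableType d) (I : finType) (K : Type)
    (g : T -> I) (phi : I -> K) (k : K) :
  (forall i, measurable (g @^-1` [set i])) ->
  measurable [set t | phi (g t) = k].
Proof.
move=> mg.
rewrite (_ : [set t | _] = \bigcup_(i in [set i | phi i = k]) g @^-1` [set i]).
  exact: fin_bigcup_measurable.
by apply/seteqP; split=> [t kt|t [i ik /= ->]//]; exists (g t).
Qed.

Section argmin.
Context (R : realType) d (T : measurableType d) (I : finType) (F : I -> T -> R).
Hypothesis mF : forall i, measurable_fun [set: T] (F i).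

(** [i0] is a mere default: the minimum is attained, so [pick] succeeds. *)
Definition fin_argmin (i0 : I) (t : T) : I :=
  odflt i0 [pick i | F i t <= fin_min (F ^~ t)].

Lemma fin_argminP i0 t : F (fin_argmin i0 t) t = fin_min (F ^~ t).
Proof.
apply/eqP; rewrite eq_le fin_min_le andbT /fin_argmin.
case: pickP => [i //|noi].
by have [j Fj] := fin_min_attained (F ^~ t) i0; have := noi j; rewrite Fj lexx.
Qed.

(** The selected index depends only on the finite vector of truth values of the comparisons with the
    minimum, each of them measurable in [t]. *)
Lemma measurable_fin_argmin i0 i : measurable (fin_argmin i0 @^-1` [set i]).
Proof.
pose g t := [ffun j => F j t <= fin_min (F ^~ t)].
rewrite (_ : _ @^-1` _ = [set t | odflt i0 [pick j | g t j] = i]); last first.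
  apply/seteqP; split=> t /=; rewrite /fin_argmin => <-; congr (odflt _ _);
    by apply: eq_pick => j; rewrite ffunE.
apply: (measurable_fiber_comp (fun b : {ffun I -> bool} => odflt i0 [pick j | b j])).
move=> b; rewrite (_ : _ @^-1` _ = \bigcap_(j in [set: I])
    ((fun t => F j t <= fin_min (F ^~ t)) @^-1` [set b j])); last first.
  apply/seteqP; split=> [t /= <- j _|t bt]; first by rewrite /= ffunE.
  by apply/ffunP => j; rewrite ffunE; exact: bt.
apply: fin_bigcap_measurable => // j _; rewrite -[X in measurable X]setTI.
by apply: measurable_fun_ler => //; exact: measurable_fin_min.
Qed.

End argmin.

(** * Error of the pointwise minimizing classifier *)

Section upper_bound.
Context (R : realType) (J : nat) d (Y : measurableType d).
Context (L : {measure set Y -> \bar R}) (theta : hmm_param J L).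
Context d' (Omega : measurableType d') (P : probability Omega R).
Context (X : nat -> Omega -> 'I_J) (Z : nat -> {RV P >-> Y}).
Hypothesis hXZ : is_hmm theta X Z.
Local Notation f := (dens theta).
Local Notation Q := (trans_mx theta).
Local Notation nu := (init_law theta ord0).
Variable delta : R.
Hypotheses (Qdelta : forall x y, delta <= Q x y) (nudelta : forall x, delta <= nu x).
Local Notation q := (1 - (J%:R - 1) * delta).

(** At time 0 the initial law is bounded by [q]; later, given any path up to the previous time, the
    next label is drawn from a row of [Q], whose entries are at most [q]. *)
Lemma label_probability_le i x : (P (X i @^-1` [set x]) <= q%:E)%E.
Proof.
case: i => [|m].
  rewrite (hmm_init hXZ) lee_fin; apply: stochastic_le => //.
  exact: init_law_sum1.
rewrite (probability_fibers P (g := fun w => [ffun j : 'I_m.+1 => X j w])); last 2 first.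
- by move=> c; rewrite -path_event_ffun; exact: (measurable_path_event hXZ).
- exact: (hmm_labels_measurable hXZ).
apply: (@le_trans _ _ (\sum_(c : {ffun 'I_m.+1 -> 'I_J})
    (q * path_weight theta m (path_of c))%:E)%E); last first.
  by rewrite sumEFin -mulr_sumr (sum_path_weight hXZ) mulr1.
apply: lee_sum => c _; rewrite -path_event_ffun.
rewrite (_ : _ `&` _ = path_event X m.+1 (update (path_of c) m.+1 x)); last first.
  rewrite path_eventS /update eqxx; congr (_ `&` _).
  by apply: eq_path_event => k km; rewrite ltn_eqF.
have -> := probability_path_event hXZ m.+1 (update (path_of c) m.+1 x).
rewrite lee_fin path_weightS (@eq_path_weight _ _ _ _ _ theta m _ (path_of c)); last first.
  by move=> k km; rewrite /update ltn_eqF.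
rewrite mulrC ler_wpM2r//.
  apply: mulr_ge0; first exact: init_law_ge0.
  by apply: prodr_ge0 => *; exact: trans_mx_ge0.
by apply: stochastic_le => //; exact: trans_mx_sum1.
Qed.

(** [hmm_emission] is applied up to time [i] with full sets at the earlier times, whose emission
    factors are 1. *)
Lemma probability_label_obs i x (A : set Y) : measurable A ->
  P (X i @^-1` [set x] `&` Z i @^-1` A) =
  (P (X i @^-1` [set x]) * \int[L]_(y in A) (f x y)%:E)%E.
Proof.
move=> mA; have mX : measurable (X i @^-1` [set x]) by exact: (hmm_labels_measurable hXZ).
have mA' k : measurable (if k == i then A else setT) by case: ifP.
have sX : sigma_labels X (X i @^-1` [set x]).
  by apply: sub_sigma_algebra; exists i, x.
have := hmm_emission hXZ i.+1 (A := fun k => if k == i then A else setT) mA' sX.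
rewrite (_ : [set w | _] = Z i @^-1` A); last first.
  apply/seteqP; split=> w; first by move=> /(_ i (ltnSn i)); rewrite eqxx.
  by move=> Aw k _; case: eqP => // ->.
move=> ->.
rewrite [LHS](eq_integral (cst (\int[L]_(y in A) (f x y)%:E)%E)).
  by rewrite integral_cst// muleC.
move=> w /[!inE] wx; rewrite (bigD1 ord_max)//= eqxx wx big1 ?mule1// => j.
by rewrite -val_eqE/= => /negPf ->; exact: dens_int1.
Qed.

Local Notation label_miss := (fun x0 y => \sum_(x | x != x0) f x y).

(** Splitting by the label gives, for each [x], its probability, at most [q], times the mass of
    [f x] where the classifier differs from [x]. Summed under the integral these masses give the
    attained minimum, hence [Lambda theta]. *)
Lemma plug_in_error_le i x0 :
  (P [set w | fin_argmin label_miss x0 (Z i w) != X i w]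
   <= q%:E * Lambda theta)%E.
Proof.
set a := fin_argmin _ _.
have mS x : measurable_fun [set: Y] (fun y => \sum_(x' | x' != x) f x' y).
  under eq_fun do rewrite big_mkcond.
  by apply: measurable_sum => x'; case: (x' != x) => //; exact: dens_measurable.
have ma x : measurable (a @^-1` [set x]) by exact: measurable_fin_argmin.
have maC x : measurable [set y | a y != x].
  rewrite (_ : [set t | _] = ~` (a @^-1` [set x])); first exact: measurableC.
  by apply/seteqP; split=> t /= /eqP.
have mX x : measurable (X i @^-1` [set x]) by exact: (hmm_labels_measurable hXZ).
have mZ A : measurable A -> measurable (Z i @^-1` A).
  by move=> mA; rewrite -[X in measurable X]setTI; exact: measurable_funP.
have XE x : X i @^-1` [set x] `&` [set w | a (Z i w) != X i w] =
    X i @^-1` [set x] `&` Z i @^-1` [set y | a y != x].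
  by apply/seteqP; split=> w [/= <-].
rewrite (probability_fibers P mX); last first.
  apply: (measurable_fiber_neq (g := a \o Z i)) => // x.
  by rewrite comp_preimage; exact: mZ.
have sum_le x : (P (X i @^-1` [set x] `&` [set w | a (Z i w) != X i w]) <=
  q%:E * \int[L]_(y in [set y | a y != x]) (f x y)%:E)%E.
  rewrite XE; have -> := probability_label_obs i x (maC x).
  by apply: lee_wpmul2r; [exact: dens_integral_ge0|exact: label_probability_le].
apply: (le_trans (lee_sum _ (fun x _ => sum_le x))).
have q0 : (0 <= q%:E)%E by exact: le_trans (label_probability_le 0 x0).
rewrite -ge0_sume_distrr; last by move=> x _; exact: dens_integral_ge0.
apply: lee_wpmul2l => //.
under eq_bigr do rewrite integral_mkcond.
have mf x : measurable_fun [set: Y] ((fun y => (f x y)%:E) \_ [set y | a y != x]).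
  apply/(measurable_restrictT _ (maC x)).
  by apply/measurable_EFinP/measurable_funTS; exact: dens_measurable.
rewrite -ge0_integral_sum//; last first.
  by move=> x y _; rewrite erestrict_ge0// => *; rewrite lee_fin dens_ge0.
rewrite le_eqVlt; apply/orP; left; apply/eqP; apply: eq_integral => y _.
rewrite -(fin_argminP label_miss x0) -/a.
rewrite (eq_bigr (fun x => (if x != a y then f x y else 0%R)%:E)).
  by rewrite sumEFin -big_mkcond.
move=> x _; rewrite /patch eq_sym; case: ifP => [|/negP]; rewrite inE/=; first by move=> ->.
by move=> /negP; case: ifP.
Qed.

End upper_bound.

(** * The risk as the average of the site errors, and the two-sided bounds *)

Section risk.
Context (R : realType) (J : nat) d (Y : measurableType d).
Context d' (Omega : measurableType d') (P : probability Omega R).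
Context (X : nat -> Omega -> 'I_J) (Z : nat -> {RV P >-> Y}).

Lemma class_riskE n (h : n.-tuple Y -> n.-tuple 'I_J) :
  (forall i : 'I_n, measurable [set w | tnth (h (observations Z n w)) i != X i w]) ->
  class_risk X Z h =
  ((n%:R^-1)%:E * \sum_(i < n) P [set w | tnth (h (observations Z n w)) i != X i w])%E.
Proof.
pose err (i : 'I_n) := [set w | tnth (h (observations Z n w)) i != X i w].
move=> me; rewrite /class_risk unlock.
have errE i w : (tnth (h [tuple Z i w | i < n]) i != X i w)%:R = \1_(err i) w :> R.
  by rewrite indicE; congr (nat_of_bool _)%:R; apply/idP/idP; rewrite inE.
under eq_integral do under eq_bigr do rewrite errE.
under eq_integral do rewrite EFinM -sumEFin.
have m1 i : measurable_fun [set: Omega] (fun w => (\1_(err i) w)%:E : \bar R).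
  by apply/measurable_EFinP; apply: measurable_indic; exact: me.
rewrite ge0_integralZl//; last 2 first.
- exact: emeasurable_sum.
- by move=> w _; apply: sume_ge0 => i _; rewrite lee_fin.
congr (_ * _)%E; rewrite ge0_integral_sum//.
by apply: eq_bigr => i _; rewrite integral_indic ?setIT//; exact: me.
Qed.

End risk.

Unset Implicit Arguments.
Set Strict Implicit.

Theorem theorem12 (R : realType) (J : nat) (hJ : (2 <= J)%N)
    (Y : ptopologicalType) (hY : polish_space R Y)
    (L : {sigma_finite_measure set (borel Y) -> \bar R})
    (theta : hmm_param J L)
    (d : measure_display) (Omega : measurableType d) (P : probability Omega R)
    (X : nat -> Omega -> 'I_J) (Z : nat -> {RV P >-> borel Y})
    (hXZ : is_hmm theta X Z) :
  let delta := fin_min (fun p : 'I_J * 'I_J => trans_mx theta p.1 p.2) in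
  0 < delta ->
  delta <= fin_min (fun x => init_law theta ord0 x) ->
  forall n : nat, (1 <= n)%N ->
    (Theta_ind theta ->
       (delta%:E * Lambda theta <= min_class_risk X Z n
          <= (1 - (J%:R - 1) * delta)%:E * Lambda theta)%E) /\
    (Theta_dep theta ->
       ((delta ^+ 2 / (1 - (J%:R - 1) * delta))%:E * Lambda theta
          <= min_class_risk X Z n
          <= (1 - (J%:R - 1) * delta)%:E * Lambda theta)%E).
Proof.
(* For [n = m.+1] observations the label paths have [m] transitions. *)
move=> delta delta0 delta_nu [//|m] _.
have Qdelta x y : delta <= trans_mx theta x y.
  exact: (fin_min_le (fun p : 'I_J * 'I_J => trans_mx theta p.1 p.2) (x, y)).
have nudelta x : delta <= init_law theta ord0 x.
  exact: le_trans delta_nu (fin_min_le _ x).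
have x0 : 'I_J := Ordinal (ltnW hJ).
have w0 c : 0 < path_weight theta m c by exact: path_weight_gt0 delta0 _ _ _ _.
(* A bound is written as the average of [m.+1] equal copies, to be compared with the risk site by
   site. *)
have avg (a : \bar R) : a = ((m.+1%:R^-1)%:E * \sum_(i < m.+1) a)%E.
  rewrite (eq_bigr (fun=> 1 * a)%E); last by move=> i _; rewrite mul1e.
  rewrite -ge0_sume_distrl// sumEFin sumr_const card_ord muleA -EFinM mulVf ?mul1e//.
have label_measurable h (i : 'I_m.+1) : @classifiers J _ (borel Y) m.+1 h ->
    forall x, measurable ((fun t => tnth (h t) i) @^-1` [set x]).
  by move=> mh x; exact: (measurable_fiber_comp (fun b : m.+1.-tuple 'I_J => tnth b i)).
have upper : (min_class_risk X Z m.+1 <= (1 - (J%:R - 1) * delta)%:E * Lambda theta)%E.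
  pose a := fin_argmin (fun x1 y => \sum_(x | x != x1) dens theta x y) x0.
  pose h t := [tuple a (tnth t i) | i < m.+1].
  have ma x : measurable (a @^-1` [set x]).
    apply: measurable_fin_argmin => x1; under eq_fun do rewrite big_mkcond.
    by apply: measurable_sum => x'; case: (x' != x1) => //; exact: dens_measurable.
  have hE i w : tnth (h (observations Z m.+1 w)) i = a (Z i w).
    by rewrite !tnth_mktuple.
  have mh : @classifiers J _ (borel Y) m.+1 h.
    move=> c; rewrite (_ : _ @^-1` _ = \bigcap_(i in [set: 'I_m.+1])
        ((fun t => tnth t i) @^-1` (a @^-1` [set tnth c i]))); last first.
      apply/seteqP; split=> [t /= <- i _|t ht]; first by rewrite /= tnth_mktuple.
      by apply: eq_from_tnth => i; rewrite tnth_mktuple; exact: ht.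
    apply: fin_bigcap_measurable => // i _; rewrite -[X in measurable X]setTI.
    exact: measurable_tnth.
  apply: (@le_trans _ _ (class_risk X Z h)).
    by apply: ereal_inf_lbound; exists h.
  rewrite class_riskE; last first.
    by move=> i; exact: (measurable_error hXZ i (label_measurable h i mh)).
  rewrite [leRHS]avg; apply: lee_wpmul2l; first by rewrite lee_fin.
  apply: lee_sum => i _; under eq_set do rewrite hE.
  exact: plug_in_error_le.
have lower kappa : 0 <= kappa ->
    (forall (i : 'I_m.+1) c x, kappa * \sum_x' path_weight theta m (update c i x') <=
       path_weight theta m (update c i x)) ->
    (kappa%:E * Lambda theta <= min_class_risk X Z m.+1)%E.
  move=> k0 share; apply: le_ereal_inf_tmp => _ [h mh <-].
  have mhi i := label_measurable h i mh.
  rewrite class_riskE; last first.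
    by move=> i; exact: (measurable_error hXZ i (mhi i)).
  rewrite [leLHS]avg; apply: lee_wpmul2l; first by rewrite lee_fin.
  apply: lee_sum => i _.
  exact: (site_error_ge hXZ x0 (mhi i) k0 w0 (share i)).
split=> hyp; rewrite upper andbT; apply: lower.
- exact: ltW.
- by move=> i c x; apply: path_weight_share_ind => //; rewrite -ltnS.
(* The denominator is at least [delta], through the entry of the initial law at [x0]. *)
- rewrite divr_ge0 ?sqr_ge0//; apply: (le_trans (ltW delta0)).
  apply: (le_trans (nudelta x0)); apply: stochastic_le => //.
  exact: init_law_sum1.
- by move=> i c x; apply: path_weight_share => //; rewrite -ltnS.
Qed.
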